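(* Let $\lambda\ge1$ be an integer. Consider a randomized one-pass streaming algorithm that is given as input an integer $\kappa$, followed by a stream of the edges of an $n$-vertex graph $G$ with degeneracy $\kappa(G)=\kappa$, and that (with probability at least $2/3$) produces a proper $(\kappa+\lambda)$-coloring of $G$. Such an algorithm requires $\Omega(n^2/\lambda^2)$ bits of space. Furthermore, if we require $\lambda=O(\kappa^{1/2-\gamma})$ for some constant $\gamma>0$, then the task does not admit a semi-streaming algorithm (one using $\widetilde{O}(n)$ bits of space).
   Context: The degeneracy $\kappa(G)$ is the least $k$ such that every induced subgraph of $G$ has a vertex of degree at most $k$. The stream is a listing of the edges of $G$ in arbitrary order (insertion-only). $\widetilde{O}$ hides polylogarithmic factors in $n$. *)

(* Defs.v *)
From HB Require Import structures.
From mathcomp Require Import all_boot all_order all_algebra.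
From mathcomp Require Import all_classical all_reals all_analysis.

Set Implicit Arguments.
Unset Strict Implicit.
Unset Printing Implicit Defensive.

Import Order.TTheory GRing.Theory Num.Theory.

Record graph (n : nat) := Graph {
  adj : rel 'I_n;
  adj_sym : symmetric adj;
  adj_irr : irreflexive adj
}.

Section Graphs.
Variable n : nat.
Implicit Types (G : graph n) (S : {set 'I_n}).

Definition edges G : {set {set 'I_n}} :=
  [set [set p.1; p.2] | p : 'I_n * 'I_n & adj G p.1 p.2].

Definition induced_degree G S (v : 'I_n) : nat := #|[set u in S | adj G v u]|.

Definition degenerate G (k : nat) : bool :=
  [forall S : {set 'I_n},
     (S != finset.set0) ==> [exists v in S, induced_degree G S v <= k]].

Lemma degenerate_exists G : exists k, degenerate G k.
Proof.
exists n; apply/forallP => S; apply/implyP => /set0Pn[v vS].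
apply/existsP; exists v; rewrite vS /=.
by rewrite -[leqRHS](card_ord n); exact: max_card.
Qed.

Definition degeneracy G : nat := ex_minn (degenerate_exists G).

Definition edge_stream G (st : seq {set 'I_n}) : bool :=
  perm_eq st (enum (edges G)).

Definition proper_coloring G (q : nat) (c : {ffun 'I_n -> nat}) : Prop :=
  (forall v, c v < q) /\ (forall u v, adj G u v -> c u != c v).

End Graphs.

(* One-pass algorithm on n-vertex graphs whose memory is a string of s bits.
   The first argument of [update] is the number of edges already read; together
   with the coins of [rand_algorithm] it lets an algorithm draw fresh coins at
   every step.  Neither this clock nor the coins are charged as space. *)
Record det_algorithm (n s : nat) := DetAlgorithm {
  init : nat -> s.-tuple bool;
  update : nat -> s.-tuple bool -> {set 'I_n} -> s.-tuple bool;
  output : s.-tuple bool -> {ffun 'I_n -> nat}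
}.

Fixpoint process (n s : nat) (A : det_algorithm n s) (t : nat)
    (m : s.-tuple bool) (st : seq {set 'I_n}) : s.-tuple bool :=
  if st is e :: st' then process A t.+1 (update A t m e) st' else m.

Definition run (n s : nat) (A : det_algorithm n s) (kappa : nat)
    (st : seq {set 'I_n}) : {ffun 'I_n -> nat} :=
  output A (process A 0 (init A kappa) st).

Record rand_algorithm (R : realType) (n s : nat) := RandAlgorithm {
  coin_display : measure_display;
  coins : measurableType coin_display;
  coin_law : probability coins R;
  alg_of : coins -> det_algorithm n s;
  run_measurable : forall kappa st c,
    measurable [set w | run (alg_of w) kappa st = c]%classic
}.
Arguments alg_of {R n s} r w.

(* The number of extra colors may depend on the input kappa. *)
Definition colors_with (R : realType) (n s : nat) (A : rand_algorithm R n s)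
    (lambda : nat -> nat) : Prop :=
  forall (G : graph n) (st : seq {set 'I_n}), edge_stream G st ->
  let kappa := degeneracy G in
  ((2 / 3 : R)%R%:E <=
   coin_law A [set w | proper_coloring G (kappa + lambda kappa)
                         (run (alg_of A w) kappa st)]%classic)%E.

Definition soft_linear (R : realType) (s : nat -> nat) : Prop :=
  exists (C : R) (k n0 : nat), forall n, n0 <= n ->
    ((s n)%:R <= C * n%:R * ln n%:R ^+ k)%R.

Definition admits_semi_streaming (R : realType) (lambda : nat -> nat -> nat) :
    Prop :=
  exists (s : nat -> nat) (A : forall n, rand_algorithm R n (s n)),
    soft_linear R s /\ forall n, colors_with (A n) (lambda n).

(* Main.v *)
Require Import Defs.
From HB Require Import structures.
From mathcomp Require Import all_boot all_order all_algebra.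
From mathcomp Require Import all_classical all_reals all_analysis.
From mathcomp Require Import measurable_realfun.
From mathcomp Require Import zify ring lra.

(** A coloring algorithm solves the INDEX problem.  Alice encodes an m x m bit
    matrix x by blocks A_i, B_j^0, B_j^1 of t >= lambda vertices each, joining
    A_i completely to B_j^b for b = x(i,j).  To read x(i,j), Bob adds a hub
    clique of k vertices joined to A_i, B_j^0 and B_j^1, makes A_i a clique and
    B_j^0 u B_j^1 a clique.  Whatever x is, the degeneracy is k + 2t - 1, so
    Alice knows kappa in advance.  A coloring with at most k + 3t - 1 colors
    forces A_i to share a color with the block B_j^b it is not joined to, which
    reveals the bit.  Alice's number of edges does not depend on x either, so
    the free clock tells Bob nothing.

    INDEX on N bits needs N/15 bits of memory: for suitable fixed coins, x and
    the string decoded from its message agree on a(x) bits, with average at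
    least 2N/3, so by convexity the sum of 2^a(x) is at least 2^N 2^(2N/3),
    while every one of the 2^s messages contributes at most 3^N; and
    2^(5/3) > 3.  Taking N = m^2 with m of order n/t gives the space bound
    n^2/lambda^2, and t of order n^(1/2-gamma) gives n^(1+2 gamma), beyond any
    n polylog(n). *)

Set Implicit Arguments.
Unset Strict Implicit.
Unset Printing Implicit Defensive.

Import Order.TTheory GRing.Theory Num.Theory.

Lemma bounded_nat_fun_attains_max (T : Type) (w0 : T) (f : T -> nat) (b : nat) :
  (forall w, f w <= b) -> exists w, forall w', f w' <= f w.
Proof.
move=> f_le; pose attained k := `[< exists w, f w = k >].
have attained_ex : exists k, attained k.
  by exists (f w0); apply/asboolP; exists w0.
have attained_le k : attained k -> k <= b by case/asboolP => w <-.
case: (ex_maxnP attained_ex attained_le) => _ /asboolP[w <-] w_max.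
by exists w => w'; apply: w_max; apply/asboolP; exists w'.
Qed.

Lemma exists_many_events (R : realType) (d : measure_display)
    (T : measurableType d) (P : probability T R) (J : finType)
    (E : J -> set T) (p : R) :
  (forall j, measurable (E j)) -> (forall j, (p%:E <= P (E j))%E) ->
  exists w, (p * #|J|%:R <= #|[set j | w \in E j]|%:R)%R.
Proof.
move=> mE PE; pose hits w := #|[set j | w \in E j]|.
have hits_sum w : ((hits w)%:R%:E = \sum_j (\1_(E j) w)%:E :> \bar R)%E.
  rewrite sumEFin /hits -sum1dep_card natr_sum big_mkcond; congr EFin.
  by apply: eq_bigr => j _; rewrite indicE; case: (w \in E j).
have /classical_sets.set0P[w0 _] : [set: T]%classic != classical_sets.set0.
  apply/eqP => T0; have := @probability_setT _ _ _ P.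
  by rewrite T0 measure0 => /eqP; rewrite eq_sym onee_eq0.
have [w hits_max] : exists w, forall w', hits w' <= hits w.
  by apply: (bounded_nat_fun_attains_max w0) => w; exact: max_card.
exists w; rewrite -lee_fin.
have mean_hits : (\sum_j P (E j) = \int[P]_w (hits w)%:R%:E)%E.
  under eq_integral do rewrite hits_sum.
  rewrite ge0_integral_sum //.
  - by apply: eq_bigr => j _; rewrite integral_indic // setIT.
  - by move=> j; apply/measurable_EFinP; exact: measurable_indic.
apply: (@le_trans _ _ (\sum_j P (E j))%E).
  by rewrite mulr_natr -sumr_const -sumEFin; apply: lee_sum.
rewrite mean_hits -[leRHS]mule1 -(@probability_setT _ _ _ P) -integral_cst //.
apply: ge0_le_integral => // [|w' _]; last by rewrite lee_fin ler_nat.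
under eq_fun do rewrite hits_sum.
by apply: emeasurable_sum => j; apply/measurable_EFinP; exact: measurable_indic.
Qed.

Lemma expR_mean_le (R : realType) (J : finType) (a : J -> R) (L : R) :
  (#|J|%:R * L <= \sum_j a j)%R ->
  (#|J|%:R * expR L <= \sum_j expR (a j))%R.
Proof.
move=> mean_ge.
have tangent j : (expR L * (1 + (a j - L)) <= expR (a j))%R.
  by rewrite -[in leRHS](subrKC L (a j)) expRD ler_pM2l ?expR_gt0 // expR_ge1Dx.
apply: (@le_trans _ _ (\sum_j expR L * (1 + (a j - L)))%R); last exact: ler_sum.
rewrite -mulr_sumr mulrC ler_pM2l ?expR_gt0 // big_split /= sumrB !sumr_const.
by rewrite -[(L *+ _)%R]mulr_natl lerDl subr_ge0.
Qed.

Section Index.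
Variables (R : realType) (I : finType).
Local Open Scope ring_scope.
Implicit Types x y : {ffun I -> bool}.

Definition agreement x y : nat := #|[set i | x i == y i]|.

Lemma sum_exp_agreement (A : comPzSemiRingType) (a : A) y :
  \sum_x a ^+ agreement x y = (a + 1) ^+ #|I|.
Proof.
transitivity (\sum_(x : {ffun I -> bool})
    \prod_i (if x i == y i then a else 1)).
  apply: eq_bigr => x _; rewrite -big_mkcond /= prodr_const.
  by congr (_ ^+ _); apply: eq_card => i; rewrite !inE.
rewrite -(bigA_distr_bigA (fun i b => if b == y i then a else 1)) /=.
under eq_bigr => i _.
  have -> : \sum_b (if b == y i then a else 1) = a + 1.
    by rewrite big_bool; case: (y i); rewrite //= addrC.
  over.
by rewrite prodr_const.
Qed.

Lemma index_code_bound (M : finType) (enc : {ffun I -> bool} -> M)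
    (dec : M -> {ffun I -> bool}) (p : R) :
  (p * #|I|%:R) * #|{ffun I -> bool}|%:R <=
    (\sum_x agreement x (dec (enc x)))%:R ->
  2 ^+ #|I| * 2 `^ (p * #|I|%:R) <= #|M|%:R * 3 ^+ #|I| :> R.
Proof.
move=> agree; set N := #|I| in agree *.
have ln2_gt0 : 0 < ln 2 :> R by rewrite ln_gt0 // ltr1n.
have exp2E k : 2 ^+ k = expR (k%:R * ln 2) :> R.
  by rewrite expRM_natl lnK // posrE.
have -> : 2 ^+ N = #|{ffun I -> bool}|%:R :> R.
  by rewrite card_ffun card_bool natrX.
rewrite /powR ifF; last by rewrite pnatr_eq0.
apply: (@le_trans _ _ (\sum_x 2 ^+ agreement x (dec (enc x)))).
  under [leRHS]eq_bigr do rewrite exp2E.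
  apply: expR_mean_le; rewrite -mulr_suml -natr_sum mulrA ler_pM2r //.
  by rewrite mulrC.
rewrite mulr_natl -sumr_const.
have -> : 3 = 2 + 1 :> R by rewrite natr1.
under [leRHS]eq_bigr => m _ do rewrite -(sum_exp_agreement 2 (dec m)).
rewrite exchange_big /=; apply: ler_sum => x _.
by rewrite (bigD1 (enc x)) //= lerDl sumr_ge0 // => m _; rewrite exprn_ge0.
Qed.

End Index.

Lemma two_thirds_bits_bound (R : realType) (N s : nat) :
  (2 ^+ N * 2 `^ (2 / 3 * N%:R) <= 2 ^+ s * 3 ^+ N :> R)%R -> N <= 15 * s.
Proof.
have pow15 : ((2 `^ (2 / 3 * N%:R)) ^+ 15 = 2 ^+ (10 * N) :> R)%R.
  rewrite -powR_mulrn ?powR_ge0 // -powRrM -powR_mulrn // natrM.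
  by congr (_ `^ _)%R; field.
have three_pow5 : (3 ^+ 5 <= 2 ^+ 8 :> R)%R by rewrite -!natrX ler_nat.
rewrite -(ler_pXn2r (isT : 0 < 15)) ?nnegrE ?mulr_ge0 ?powR_ge0 ?exprn_ge0 //.
rewrite !exprMn pow15 -!exprM -exprD => bound.
have : (2 ^+ (N * 15 + 10 * N) <= 2 ^+ (s * 15 + 8 * (3 * N)) :> R)%R.
  apply: le_trans bound _; rewrite exprD ler_pM2l ?exprn_gt0 //.
  rewrite (_ : N * 15 = 5 * (3 * N)); last by lia.
  by rewrite !exprM !lerXn2r ?nnegrE ?exprn_ge0.
by rewrite ler_eXn2l ?ltr1n //; lia.
Qed.

Lemma index_space_bound (R : realType) (d : measure_display)
    (T : measurableType d) (P : probability T R) (I : finType) (s : nat)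
    (E : {ffun I -> bool} -> I -> set T)
    (enc : T -> {ffun I -> bool} -> s.-tuple bool)
    (dec : T -> s.-tuple bool -> I -> bool) :
  (forall x i, measurable (E x i)) ->
  (forall x i, ((2 / 3 : R)%R%:E <= P (E x i))%E) ->
  (forall w x i, E x i w -> dec w (enc w x) i = x i) ->
  #|I| <= 15 * s.
Proof.
move=> mE PE decE.
have [w many] := exists_many_events (E := fun j => E j.1 j.2)
  (fun j => mE j.1 j.2) (fun j => PE j.1 j.2).
have hits_le : #|[set j | w \in E j.1 j.2]| <=
    \sum_x agreement x [ffun i => dec w (enc w x) i].
  rewrite -sum1dep_card big_mkcond.
  rewrite -(pair_bigA _ (fun x i => if w \in E x i then 1 else 0)) /=.
  apply: leq_sum => x _; rewrite -big_mkcond sum1dep_card.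
  apply: subset_leq_card; apply/fintype.subsetP => i; rewrite !inE ffunE.
  by move=> /decE->.
have := @index_code_bound R I _ (enc w)
  (fun mem => [ffun i => dec w mem i]) (2 / 3).
rewrite -mulrA -natrM mulnC -card_prod => /(_ (le_trans many _)).
rewrite ler_nat => /(_ hits_le); rewrite card_tuple card_bool natrX.
exact: two_thirds_bits_bound.
Qed.

Lemma leq_card_inj_bounded (T : finType) (S : {set T}) (c : T -> nat)
    (N : nat) :
  {in S &, injective c} -> (forall v, c v < N) -> #|S| <= N.
Proof.
move=> c_inj c_lt; rewrite -[leqRHS]card_ord.
apply: (@leq_card_in _ _ (fun v => Ordinal (c_lt v))) => u v uS vS [].
exact: c_inj.
Qed.

Section Degeneracy.
Variables (n : nat) (G : graph n).

Lemma degeneracy_leq_rank (rank : 'I_n -> nat) (d : nat) :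
  (forall v, #|[set u | adj G v u & rank v <= rank u]| <= d) ->
  degeneracy G <= d.
Proof.
move=> deg_le; rewrite /degeneracy; case: ex_minnP => k _; apply.
apply/forallP => S; apply/implyP => /set0Pn[v0 v0S].
have [v vS v_min] := arg_minnP rank v0S.
apply/existsP; exists v; apply/andP; split=> //; apply: leq_trans (deg_le v).
apply: subset_leq_card; apply/fintype.subsetP => u; rewrite !inE.
by case/andP=> uS ->; exact: v_min.
Qed.

Lemma card_clique_degeneracy (K : {set 'I_n}) :
  {in K &, forall u v, u != v -> adj G u v} -> #|K| <= (degeneracy G).+1.
Proof.
move=> clique; rewrite /degeneracy; case: ex_minnP => k /forallP/(_ K) deg_k _.
have [-> | K_neq0] := eqVneq K finset.set0; first by rewrite cards0.
have /existsP[v /andP[vK]] := implyP deg_k K_neq0.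
rewrite (cardsD1 v K) vK add1n ltnS; apply: leq_trans.
apply: subset_leq_card; apply/fintype.subsetP => u.
by rewrite !inE => /andP[uv uK]; rewrite uK clique // eq_sym.
Qed.

End Degeneracy.

Section Edges.
Variable n : nat.
Implicit Types G : graph n.

Lemma edgesP G e :
  reflect (exists u v, adj G u v /\ e = [set u; v]) (e \in edges G).
Proof.
apply: (iffP imsetP) => [[[u v]] | [u [v [uv ->]]]].
  by rewrite inE /= => uv ->; exists u, v.
by exists (u, v); rewrite ?inE.
Qed.

Lemma mem_edges G u v : ([set u; v] \in edges G) = adj G u v.
Proof.
apply/edgesP/idP => [[a [b [ab E]]] | uv]; last by exists u, v.
have /set2P aE : a \in [set u; v] by rewrite E set21.
have /set2P bE : b \in [set u; v] by rewrite E set22.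
case: aE bE ab => -> [] -> //; rewrite ?(adj_irr G) //.
by rewrite (adj_sym G).
Qed.

Lemma edge_stream_cat G G1 G2 st1 st2 :
  (forall u v, adj G u v = adj G1 u v || adj G2 u v) ->
  (forall u v, adj G1 u v -> ~~ adj G2 u v) ->
  edge_stream G1 st1 -> edge_stream G2 st2 -> edge_stream G (st1 ++ st2).
Proof.
move=> adjE adj_disj st1P st2P; apply: perm_trans (perm_cat st1P st2P) _.
apply: uniq_perm => [||e]; rewrite ?enum_uniq //.
  rewrite cat_uniq !enum_uniq andbT; apply/hasPn => e; rewrite /= !mem_enum.
  case/edgesP=> u [v [uv ->]]; rewrite mem_edges.
  by apply: contraL uv => /adj_disj.
rewrite mem_cat !mem_enum; apply/orP/edgesP => [[] /edgesP | ] [u [v [uv ->]]].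
- by exists u, v; rewrite adjE uv.
- by exists u, v; rewrite adjE uv orbT.
- by rewrite !mem_edges; apply/orP; rewrite -adjE.
Qed.

End Edges.

Section GraphOn.
Variables (W : finType) (r : rel W).
Hypotheses (r_sym : symmetric r) (r_irr : irreflexive r).

Definition graph_on : graph #|W| :=
  @Graph _ (fun u v => r (enum_val u) (enum_val v))
    (fun u v => r_sym (enum_val u) (enum_val v)) (fun u => r_irr (enum_val u)).

Lemma degeneracy_graph_on_leq_rank (rank : W -> nat) (d : nat) :
  (forall a, #|[set b | r a b & rank a <= rank b]| <= d) ->
  degeneracy graph_on <= d.
Proof.
move=> deg_le; apply: (@degeneracy_leq_rank _ _ (rank \o enum_val)) => v.
apply: leq_trans (deg_le (enum_val v)).
rewrite -(card_imset _ (@enum_val_inj _ W)); apply: subset_leq_card.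
by apply/fintype.subsetP => _ /imsetP[u + ->]; rewrite !inE.
Qed.

Lemma card_clique_degeneracy_graph_on (K : {set W}) :
  {in K &, forall a b, a != b -> r a b} -> #|K| <= (degeneracy graph_on).+1.
Proof.
move=> clique; rewrite -(card_imset _ enum_rank_inj).
apply: card_clique_degeneracy => _ _ /imsetP[a aK ->] /imsetP[b bK ->] ab.
by rewrite /= !enum_rankK clique //; apply: contraNneq ab => ->.
Qed.

Lemma adj_graph_on (a b : W) :
  adj graph_on (enum_rank a) (enum_rank b) = r a b.
Proof. by rewrite /= !enum_rankK. Qed.

End GraphOn.

Section Gadget.
Variables m t k : nat.

Local Notation part := (option (option bool * 'I_m)).
Local Notation hub := None (only parsing).
Local Notation blockA i := (Some (None, i)) (only parsing).
Local Notation blockB b j := (Some (Some b, j)) (only parsing).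

Definition gadget : finType := ((option bool * 'I_m) * 'I_t + 'I_k)%type.

Definition part_of (u : gadget) : part :=
  if u is inl (p, _) then Some p else hub.

Definition part_size (p : part) : nat := if p is Some _ then t else k.

Definition blowup (Q : {set part}) : {set gadget} := [set u | part_of u \in Q].

Implicit Types (x : {ffun 'I_m * 'I_m -> bool}) (q : 'I_m * 'I_m).
Implicit Types (p : part) (u v : gadget) (Q : {set part}).

Lemma card_part p : #|[set u | part_of u == p]| = part_size p.
Proof.
case: p => [p|]; rewrite -[RHS]card_ord.
  rewrite -(@card_imset _ _ (fun c => inl (p, c) : gadget)) => [|c c' [] //].
  apply: eq_card => u; rewrite inE; apply/eqP/imsetP => [|[c _ -> //]].
  by case: u => [[p' c]|h] //= [->]; exists c.
rewrite -(@card_imset _ _ (fun h => inr h : gadget)) => [|h h' [] //].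
apply: eq_card => u; rewrite inE; apply/eqP/imsetP => [|[h _ -> //]].
by case: u => [[p c]|h] //= _; exists h.
Qed.

Lemma card_blowup Q : #|blowup Q| = \sum_(p in Q) part_size p.
Proof.
rewrite -sum1_card (partition_big part_of (mem Q)) => [|u]; last by rewrite inE.
apply: eq_bigr => p pQ; rewrite sum1dep_card -card_part; apply: eq_card => u.
by rewrite !inE andb_idl // => /eqP->.
Qed.

Definition alice_part x : rel part := fun p p' =>
  match p, p' with
  | blockA i, blockB b j | blockB b j, blockA i => b == x (i, j)
  | _, _ => false
  end.

Definition cross_part : rel part := fun p p' =>
  match p, p' with
  | blockA _, blockB _ _ | blockB _ _, blockA _ => true
  | _, _ => false
  end.

Definition core q : {set part} :=
  hub |: (blockA q.1 |: [set blockB false q.2; blockB true q.2]).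

Definition alice_rel x : rel gadget := fun u v =>
  alice_part x (part_of u) (part_of v).

Definition bob_rel q : rel gadget := fun u v =>
  [&& part_of u \in core q, part_of v \in core q, u != v
    & ~~ cross_part (part_of u) (part_of v)].

Definition joint_rel x q : rel gadget := fun u v =>
  alice_rel x u v || bob_rel q u v.

Lemma alice_part_cross x p p' : alice_part x p p' -> cross_part p p'.
Proof. by case: p p' => [[[b|] i]|] [[[b'|] i']|]. Qed.

Lemma alice_part_sym x : symmetric (alice_part x).
Proof. by case=> [[[b|] i]|] [[[b'|] i']|]. Qed.

Lemma cross_part_sym : symmetric cross_part.
Proof. by case=> [[[b|] i]|] [[[b'|] i']|]. Qed.

Lemma alice_sym x : symmetric (alice_rel x).
Proof. by move=> u v; exact: alice_part_sym. Qed.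

Lemma alice_irr x : irreflexive (alice_rel x).
Proof. by move=> u; rewrite /alice_rel; case: (part_of u) => [[[b|] i]|]. Qed.

Lemma bob_sym q : symmetric (bob_rel q).
Proof. by move=> u v; rewrite /bob_rel cross_part_sym eq_sym andbCA. Qed.

Lemma bob_irr q : irreflexive (bob_rel q).
Proof. by move=> u; rewrite /bob_rel eqxx !andbF. Qed.

Lemma joint_sym x q : symmetric (joint_rel x q).
Proof. by move=> u v; rewrite /joint_rel alice_sym bob_sym. Qed.

Lemma joint_irr x q : irreflexive (joint_rel x q).
Proof. by move=> u; rewrite /joint_rel bob_irr alice_irr. Qed.

Definition alice_graph x : graph #|gadget| :=
  graph_on (alice_sym x) (alice_irr x).

Definition bob_graph q : graph #|gadget| := graph_on (bob_sym q) (bob_irr q).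

Definition joint_graph x q : graph #|gadget| :=
  graph_on (joint_sym x q) (joint_irr x q).

Lemma card_blowup_core q : #|blowup (core q)| = k + 3 * t.
Proof. by rewrite card_blowup !big_setU1 ?big_set1 ?inE //=; lia. Qed.

Lemma card_blowup_coreD1 q (l : option bool * 'I_m) :
  Some l \in core q -> #|blowup (core q :\ Some l)| = k + 2 * t.
Proof.
move=> l_core; have := card_blowup_core q; rewrite !card_blowup.
rewrite (big_setD1 _ l_core) /= => cardE.
by apply: (@addnI t); rewrite cardE; lia.
Qed.

Lemma leq_alice_degree x u : #|[set v | alice_rel x u v]| <= m * t.
Proof.
pose neighbor j : option bool * 'I_m :=
  if part_of u is blockA i then (Some (x (i, j)), j) else (None, j).
pose N := [set Some (neighbor j) | j : 'I_m].
apply: (@leq_trans #|blowup N|).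
  apply: subset_leq_card; apply/fintype.subsetP => v.
  rewrite !inE /alice_rel /N /neighbor.
  case: (part_of u) (part_of v) => [[[b|] i]|] [[[b'|] j]|] //=.
    by move=> _; apply/imsetP; exists j.
  by move=> /eqP->; apply/imsetP; exists j.
rewrite card_blowup (eq_bigr (fun=> t)) => [|_ /imsetP[j _ ->] //].
by rewrite sum_nat_const leq_mul // -[leqRHS]card_ord leq_imset_card.
Qed.

(* Peeling order: the vertices outside the core, then A_i, then the rest. *)
Definition peel_rank q u : nat :=
  (part_of u \in core q) + (part_of u \in core q :\ blockA q.1).

Definition later_neighbors x q u : {set gadget} :=
  [set v | joint_rel x q u v & peel_rank q u <= peel_rank q v].

Lemma later_neighbors_sub_blowup x q u : part_of u \in core q ->
  exists l : option bool * 'I_m,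
    [/\ Some l \in core q, part_of u != Some l &
        later_neighbors x q u \subset blowup (core q :\ Some l)].
Proof.
move=> u_core; have [uA | u_not_A] := eqVneq (part_of u) (blockA q.1).
  exists (Some (~~ x q), q.2); split; rewrite ?uA //.
    by rewrite !inE; case: (x q); rewrite eqxx ?orbT.
  apply/fintype.subsetP => v; rewrite inE => /andP[uv later].
  have v_core : part_of v \in core q.
    apply: contraTT later => /negbTE v_out.
    by rewrite /peel_rank uA !finset.in_setD1 v_out -uA u_core eqxx andbF.
  rewrite inE finset.in_setD1 v_core andbT; apply: contraTneq uv => vB.
  rewrite /joint_rel /alice_rel /bob_rel uA vB /= !andbF orbF.
  by rewrite -surjective_pairing; case: (x q).
exists (None, q.1); split=> //; first by rewrite !inE eqxx.
apply/fintype.subsetP => v; rewrite inE => /andP[_]; rewrite [v \in _]inE.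
rewrite /peel_rank !finset.in_setD1 u_not_A u_core.
by case: (part_of v \in core q); case: (_ != _).
Qed.

Lemma card_later_neighbors_core x q u :
  part_of u \in core q -> #|later_neighbors x q u| <= k + 2 * t - 1.
Proof.
move=> u_core; have [l [l_core u_neq later_sub]] :=
  later_neighbors_sub_blowup x u_core.
have u_kept : u \in blowup (core q :\ Some l).
  by rewrite inE finset.in_setD1 u_neq.
rewrite -(card_blowup_coreD1 l_core) [in leqRHS](cardsD1 u) u_kept addKn.
by rewrite subset_leq_card // subsetD1 later_sub inE joint_irr.
Qed.

Lemma joint_degeneracy x q :
  m * t <= k + 2 * t - 1 -> degeneracy (joint_graph x q) = k + 2 * t - 1.
Proof.
move=> le_mt; apply/eqP; rewrite eqn_leq; apply/andP; split.
  apply: (degeneracy_graph_on_leq_rank _ _ (rank := peel_rank q)) => u.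
  have [u_core | u_out] := boolP (part_of u \in core q).
    exact: card_later_neighbors_core.
  apply: leq_trans le_mt; apply: leq_trans (leq_alice_degree x u).
  apply: subset_leq_card; apply/fintype.subsetP => v; rewrite !inE.
  by rewrite /joint_rel /bob_rel (negbTE u_out) orbF => /andP[].
have A_core : blockA q.1 \in core q by rewrite !inE eqxx.
rewrite leq_subLR add1n -(card_blowup_coreD1 A_core).
apply: card_clique_degeneracy_graph_on => u v.
rewrite [u \in _]inE [v \in _]inE => /setD1P[uA uC] /setD1P[vA vC] uv.
apply/orP; right; rewrite /bob_rel uC vC uv /=.
move: uA vA; rewrite !inE in uC vC.
by case/or4P: uC => /eqP->; case/or4P: vC => /eqP->; rewrite ?eqxx.
Qed.

Lemma card_alice_edges x : #|edges (alice_graph x)| = (m * t) ^ 2.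
Proof.
pose A i c : 'I_#|gadget| := enum_rank (inl (None, i, c) : gadget).
pose B b j d : 'I_#|gadget| := enum_rank (inl (Some b, j, d) : gadget).
pose edge (z : ('I_m * 'I_t) * ('I_m * 'I_t)) : {set 'I_#|gadget|} :=
  let: ((i, c), (j, d)) := z in [set A i c; B (x (i, j)) j d].
have edge_inj : injective edge.
  move=> [[i c] [j d]] [[i' c'] [j' d']] /= E.
  have /set2P[/enum_rank_inj[-> ->] | /enum_rank_inj //] :
    A i c \in [set A i' c'; B (x (i', j')) j' d'] by rewrite -E set21.
  have /set2P[/enum_rank_inj // | /enum_rank_inj[_ -> -> //]] :
    B (x (i, j)) j d \in [set A i' c'; B (x (i', j')) j' d'].
  by rewrite -E set22.
transitivity #|{: ('I_m * 'I_t) * ('I_m * 'I_t)}|; last first.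
  by rewrite !card_prod !card_ord mulnn.
rewrite -(card_imset _ edge_inj); apply: eq_card => e.
apply/edgesP/imsetP => [[u [v [uv ->]]] | [[[i c] [j d]] _ ->]]; last first.
  exists (A i c), (B (x (i, j)) j d).
  by rewrite adj_graph_on /alice_rel /= eqxx.
rewrite -[u]enum_valK -[v]enum_valK; move: uv; rewrite /= /alice_rel.
case: (enum_val u) (enum_val v) =>
  [[[[b|] i] c]|h] [[[[b'|] j] d]|h'] //= /eqP->.
  by exists ((j, d), (i, c)); rewrite // finset.setUC.
by exists ((i, c), (j, d)).
Qed.

Lemma edge_stream_joint x q :
  edge_stream (joint_graph x q)
    (enum (edges (alice_graph x)) ++ enum (edges (bob_graph q))).
Proof.
apply: edge_stream_cat (perm_refl _) (perm_refl _) => // u v.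
by rewrite /= /bob_rel => /alice_part_cross->; rewrite !andbF.
Qed.

Definition decode_bit (c : {ffun 'I_#|gadget| -> nat}) q : bool :=
  [forall u : gadget, forall v : gadget,
    (part_of u == blockA q.1) && (part_of v == blockB true q.2) ==>
    (c (enum_rank u) != c (enum_rank v))].

Lemma decode_bit_correct x q (N : nat) (c : {ffun 'I_#|gadget| -> nat}) :
  N < k + 3 * t -> proper_coloring (joint_graph x q) N c ->
  decode_bit c q = x q.
Proof.
move=> N_lt [c_lt c_proper].
have proper u v : joint_rel x q u v -> c (enum_rank u) != c (enum_rank v).
  by move=> uv; apply: c_proper; rewrite adj_graph_on.
have joined u v : part_of u = blockA q.1 -> part_of v = blockB (x q) q.2 ->
    c (enum_rank u) != c (enum_rank v).
  move=> uA vB; apply/proper/orP; left.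
  by rewrite /alice_rel uA vB /= -surjective_pairing eqxx.
case xq: (x q) in joined *.
  do 2![apply/forallP => ?]; apply/implyP => /andP[/eqP uA /eqP vB].
  exact: joined.
(* If A_i and B_j^true shared no color, the core would be rainbow. *)
apply: contraTF N_lt => /'forall_forallP disjoint_colors.
have A_B u v b : part_of u = blockA q.1 -> part_of v = blockB b q.2 ->
    c (enum_rank u) != c (enum_rank v).
  case: b => uA vB; last exact: joined.
  by apply: (implyP (disjoint_colors u v)); rewrite uA vB !eqxx.
rewrite -leqNgt -(card_blowup_core q).
apply: (leq_card_inj_bounded (c := c \o enum_rank)) => [u v | u] //=.
rewrite !inE => u_core v_core /eqP; apply: contraTeq => uv.
have [|not_cross] := boolP (cross_part (part_of u) (part_of v)); last first.
  apply/proper/orP; right.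
  by rewrite /bob_rel !inE u_core v_core uv not_cross.
case/or4P: u_core => /eqP uE; case/or4P: v_core => /eqP vE;
  rewrite uE vE //= => _;
  by [exact: A_B uE vE | rewrite eq_sym; exact: A_B vE uE].
Qed.

End Gadget.

Lemma process_cat (n s : nat) (A : det_algorithm n s) (time : nat)
    (mem : s.-tuple bool) (st1 st2 : seq {set 'I_n}) :
  process A time mem (st1 ++ st2) =
  process A (time + size st1) (process A time mem st1) st2.
Proof.
elim: st1 time mem => [|e st1 IH] time mem /=; first by rewrite addn0.
by rewrite IH addSnnS.
Qed.

Lemma measurable_run_preimage (R : realType) (n s : nat)
    (A : rand_algorithm R n s) (kappa : nat) (st : seq {set 'I_n})
    (Q : {ffun 'I_n -> nat} -> Prop) :
  measurable [set w | Q (run (alg_of A w) kappa st)]%classic.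
Proof.
have -> : [set w | Q (run (alg_of A w) kappa st)]%classic =
    (\bigcup_(c in Q) [set w | run (alg_of A w) kappa st = c])%classic.
  apply/seteqP; split=> [w Qw | w [c Qc /= ->]] //.
  by exists (run (alg_of A w) kappa st).
rewrite bigcup_mkcond; apply: countable_bigcupT_measurable => [|c].
  exact: countableP.
by case: ifP => // _; exact: run_measurable.
Qed.

(* Alice sends [enc B x], from which Bob, who holds [i], computes [dec B _ i];
   the deterministic algorithm [B] carries the shared coins. *)
Lemma coloring_index_bound (R : realType) (n s : nat) (A : rand_algorithm R n s)
    (lambda : nat -> nat) (I : finType)
    (G : {ffun I -> bool} -> I -> graph n)
    (st : {ffun I -> bool} -> I -> seq {set 'I_n})
    (enc : det_algorithm n s -> {ffun I -> bool} -> s.-tuple bool)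
    (dec : det_algorithm n s -> s.-tuple bool -> I -> bool) :
  colors_with A lambda -> (forall x i, edge_stream (G x i) (st x i)) ->
  (forall B x i, let kappa := degeneracy (G x i) in
     proper_coloring (G x i) (kappa + lambda kappa) (run B kappa (st x i)) ->
     dec B (enc B x) i = x i) ->
  #|I| <= 15 * s.
Proof.
move=> colA stP decE; pose kappa x i := degeneracy (G x i).
pose proper x i :=
  proper_coloring (G x i) (kappa x i + lambda (kappa x i)).
pose E x i :=
  [set w | proper x i (run (alg_of A w) (kappa x i) (st x i))]%classic.
apply: (index_space_bound (P := coin_law A) (E := E)
  (enc := enc \o alg_of A) (dec := dec \o alg_of A)) => [x i | x i | w x i].
- exact: (@measurable_run_preimage R n s A _ (st x i) (proper x i)).
- exact/colA/stP.
- exact: decE.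
Qed.

Definition empty_graph (n : nat) : graph n :=
  @Graph n (fun _ _ => false) (fun _ _ => erefl) (fun _ => erefl).

Definition complete_graph (n : nat) : graph n :=
  @Graph n (fun u v => u != v) (fun u v => congr1 negb (eq_sym u v))
    (fun u => congr1 negb (eqxx u)).

Lemma degeneracy_empty (n : nat) : degeneracy (empty_graph n) = 0.
Proof.
apply/eqP; rewrite -leqn0; apply: (@degeneracy_leq_rank _ _ (fun=> 0)) => v.
by rewrite leqn0 cards_eq0; apply/eqP/setP => u; rewrite !inE.
Qed.

(* The complete graph forces an injective coloring and the empty graph forbids
   one, so the final memory state holds at least one bit. *)
Lemma coloring_space_gt0 (R : realType) (n s : nat) (A : rand_algorithm R n s)
    (lambda : nat -> nat) :
  lambda 0 < n -> colors_with A lambda -> 0 < s.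
Proof.
move=> lt_ln colA.
pose G (x : {ffun unit -> bool}) (_ : unit) :=
  if x tt then complete_graph n else empty_graph n.
pose st x := enum (edges (G x tt)).
pose enc (B : det_algorithm n s) x :=
  process B 0 (init B (degeneracy (G x tt))) (st x).
pose dec (B : det_algorithm n s) mem (_ : unit) := injectiveb (output B mem).
suff : #|{: unit}| <= 15 * s by rewrite card_unit muln_gt0.
apply: (coloring_index_bound (G := G) (st := fun x _ => st x) (enc := enc)
  (dec := dec) colA) => [x [] | B x []]; first exact: perm_refl.
rewrite /dec /enc -/(run B _ _); move: (run _ _ _) => c [].
rewrite /G; case: (x tt) => [_ c_proper | ].
  by apply/injectiveP => u v /eqP; apply: contraTeq; exact: c_proper.
rewrite degeneracy_empty add0n => c_lt _; apply/negbTE/injectiveP => c_inj.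
move: lt_ln; rewrite ltnNge => /negP; apply.
rewrite -[leqLHS](card_ord n) -cardsT.
by apply: leq_card_inj_bounded c_lt => u v _ _ /c_inj.
Qed.

Lemma gadget_coloring_space (R : realType) (m t k s : nat)
    (A : rand_algorithm R #|gadget m t k| s) (lambda : nat -> nat) :
  0 < t -> m * t <= k + 2 * t - 1 -> lambda (k + 2 * t - 1) <= t ->
  colors_with A lambda -> m * m <= 15 * s.
Proof.
move=> t_gt0 le_mt le_lambda colA; rewrite -[m in m * m]card_ord -card_prod.
pose kappa := k + 2 * t - 1.
pose alice_stream x := enum (edges (@alice_graph m t k x)).
pose bob_stream q := enum (edges (@bob_graph m t k q)).
pose enc (B : det_algorithm _ s) x :=
  process B 0 (init B kappa) (alice_stream x).
pose dec (B : det_algorithm _ s) mem q :=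
  decode_bit (output B (process B ((m * t) ^ 2) mem (bob_stream q))) q.
apply: (coloring_index_bound (G := @joint_graph m t k)
  (st := fun x q => alice_stream x ++ bob_stream q) (enc := enc) (dec := dec)
  colA) => [x q | B x q]; first exact: edge_stream_joint.
rewrite joint_degeneracy //= => proper.
apply: (decode_bit_correct (N := kappa + lambda kappa)).
  by rewrite /kappa; lia.
by move: proper; rewrite /run process_cat add0n -cardE card_alice_edges.
Qed.

Lemma coloring_space_quadratic (R : realType) (n s t : nat)
    (A : rand_algorithm R n s) (lambda : nat -> nat) :
  0 < t -> 4 * t <= n -> colors_with A lambda ->
  (forall kappa, n <= 4 * kappa -> kappa <= n -> lambda kappa <= t) ->
  n ^ 2 <= 960 * t ^ 2 * s.
Proof.
move=> t_gt0 le_tn colA le_lambda.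
pose m := n %/ (4 * t); pose k := n - 3 * m * t.
have le_mn : m * (4 * t) <= n by exact: leq_divM.
have lt_nm : n < m.+1 * (4 * t) by rewrite -ltn_divLR // muln_gt0.
have m_gt0 : 0 < m by rewrite divn_gt0 // muln_gt0.
have card_gadget : #|gadget m t k| = n.
  by rewrite card_sum !card_prod card_option card_bool !card_ord /k; lia.
have le_m2 : m * m <= 15 * s.
  move: A colA; rewrite -card_gadget => A colA.
  have le_tmt : t <= m * t by rewrite leq_pmull.
  by apply: gadget_coloring_space colA; rewrite ?le_lambda //; rewrite /k; nia.
have le_n : n <= 8 * t * m by nia.
nia.
Qed.

Lemma coloring_space_lower_bound (R : realType) (lambda n s : nat)
    (A : rand_algorithm R n s) :
  1 <= lambda -> lambda < n -> colors_with A (fun=> lambda) ->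
  (960^-1 * (n%:R ^+ 2 / lambda%:R ^+ 2) <= s%:R :> R)%R.
Proof.
move=> l_gt0 lt_ln colA.
have bound : n ^ 2 <= 960 * lambda ^ 2 * s.
  have [le_ln | lt_nl] := leqP (4 * lambda) n.
    exact: coloring_space_quadratic colA _.
  by have := coloring_space_gt0 lt_ln colA; nia.
rewrite mulrA ler_pdivrMr ?exprn_gt0 ?ltr0n // mulrC ler_pdivrMr ?ltr0n //.
by rewrite -!natrX -!natrM ler_nat; lia.
Qed.

Section Asymptotics.
Variable R : realType.
Local Open Scope classical_set_scope.
Local Open Scope ring_scope.
Implicit Types K C e : R.

Lemma near_ln_exp_lt_powR K e (k : nat) : 0 < e ->
  \forall n \near \oo, K * ln n%:R ^+ k < n%:R `^ e.
Proof.
move=> e_gt0; pose c : R := e ^+ k.+1 / k.+1`!%:R.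
have c_gt0 : 0 < c by rewrite divr_gt0 ?exprn_gt0 // ltr0n fact_gt0.
near=> n.
have n_gt0 : 0 < n%:R :> R by rewrite ltr0n; near: n; exact: nbhs_infty_gt.
have ln_ge0 : 0 <= ln n%:R :> R by rewrite ln_ge0 // ler1n -(ltr0n R).
have ln_large : K <= c * ln n%:R.
  rewrite mulrC -ler_pdivrMr // -ler_expR lnK ?posrE //.
  by near: n; exact: nbhs_infty_ger.
have -> : n%:R `^ e = expR (e * ln n%:R) by rewrite /powR gt_eqF.
have elnn_ge0 : 0 <= e * ln n%:R by rewrite mulr_ge0 // ltW.
apply: lt_le_trans (expR_ge1Dxn k elnn_ge0).
apply: (@le_lt_trans _ _ (c * ln n%:R * ln n%:R ^+ k)).
  by rewrite ler_wpM2r // exprn_ge0.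
by rewrite exprMn [in ltRHS]mulrAC -/c -[ltLHS]mulrA -exprS ltrDr.
Unshelve. all: by end_near. Qed.

Lemma near_powR_threshold C e : 0 <= C -> 0 <= e < 1 ->
  \forall n \near \oo, exists t : nat,
    [/\ (0 < t)%N, (4 * t <= n)%N, C * n%:R `^ e <= t%:R
      & t%:R <= (C + 1) * n%:R `^ e].
Proof.
move=> C_ge0 /andP[e_ge0 e_lt1]; near=> n.
have n_gt0 : (0 < n)%N by near: n; exact: nbhs_infty_gt.
have pow_ge1 : 1 <= n%:R `^ e.
  by rewrite -[leLHS](powRr0 n%:R) ler_powR // ler1n.
pose t := (Num.truncn (C * n%:R `^ e)).+1.
have t_le : t%:R <= (C + 1) * n%:R `^ e.
  rewrite -natr1 mulrDl mul1r lerD // truncn_le //.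
  by rewrite mulr_ge0 // powR_ge0.
exists t; split=> //; last by apply: ltW; exact: truncnS_gt.
rewrite -(ler_nat R) natrM.
apply: (@le_trans _ _ (4 * ((C + 1) * n%:R `^ e))); first by rewrite ler_wpM2l.
have split_n : n%:R = n%:R `^ (1 - e) * n%:R `^ e :> R.
  by rewrite -powRD ?subrK ?powRr1 // pnatr_eq0 -lt0n n_gt0 implybT.
rewrite mulrA [leRHS]split_n ler_wpM2r ?powR_ge0 //.
apply: ltW; rewrite -[ltLHS]mulr1 -[X in _ * X](expr0 (ln n%:R)).
by near: n; apply: near_ln_exp_lt_powR; rewrite subr_gt0.
Unshelve. all: by end_near. Qed.

Lemma near_soft_linear_lt_sqr (s : nat -> nat) K e :
  0 <= K -> e < 2^-1 -> soft_linear R s ->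
  \forall n \near \oo, K * (n%:R `^ e) ^+ 2 * (s n)%:R < n%:R ^+ 2.
Proof.
move=> K_ge0 e_lt [C [k [n0 s_le]]]; near=> n.
have n_gt0 : (0 < n)%N by near: n; exact: nbhs_infty_gt.
have nR_gt0 : 0 < n%:R :> R by rewrite ltr0n.
have {}s_le : (s n)%:R <= C * n%:R * ln n%:R ^+ k.
  by apply: s_le; near: n; exact: nbhs_infty_ge.
set p := n%:R `^ e.
have -> : n%:R ^+ 2 = n%:R `^ (1 - 2 * e) * (p ^+ 2 * n%:R) :> R.
  rewrite mulrA expr2 -[p ^+ 2]powR_mulrn ?powR_ge0 // -powRrM [e * _]mulrC.
  by rewrite -powRD ?subrK ?powRr1 // pnatr_eq0 -lt0n n_gt0 implybT.
apply: (@le_lt_trans _ _ (K * C * ln n%:R ^+ k * (p ^+ 2 * n%:R))).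
  have -> : K * C * ln n%:R ^+ k * (p ^+ 2 * n%:R) =
      K * p ^+ 2 * (C * n%:R * ln n%:R ^+ k) by ring.
  by rewrite ler_wpM2l // mulr_ge0 // exprn_ge0 // powR_ge0.
rewrite ltr_pM2r ?mulr_gt0 ?exprn_gt0 ?powR_gt0 //.
by near: n; apply: near_ln_exp_lt_powR; lra.
Unshelve. all: by end_near. Qed.

End Asymptotics.

Lemma no_semi_streaming_nneg_exponent (R : realType)
    (lambda : nat -> nat -> nat) (C e : R) (kappa0 : nat) :
  (0 <= C)%R -> (0 <= e < 2^-1)%R ->
  (forall n kappa, kappa0 <= kappa ->
     ((lambda n kappa)%:R <= C * kappa%:R `^ e)%R) ->
  ~ admits_semi_streaming R lambda.
Proof.
move=> C_ge0 /andP[e_ge0 e_lt] lambda_le [s [A [soft_s colA]]].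
suff: (\forall n \near \oo, False)%classic by case=> n _ /(_ n (leqnn n)).
have e_lt1 : (0 <= e < 1)%R by rewrite e_ge0; lra.
have K_ge0 : (0 <= 960 * (C + 1) ^+ 2)%R.
  by rewrite mulr_ge0 ?ler0n ?exprn_ge0 ?addr_ge0.
near=> n.
have [t [t_gt0 le_tn t_ge t_le]] : exists t, [/\ 0 < t, 4 * t <= n,
    (C * n%:R `^ e <= t%:R)%R & (t%:R <= (C + 1) * n%:R `^ e)%R].
  by near: n; exact: near_powR_threshold.
have lambda_le_t kappa : n <= 4 * kappa -> kappa <= n -> lambda n kappa <= t.
  move=> le_n4k le_kn; rewrite -(ler_nat R); apply: le_trans t_ge.
  have kappa0_le : kappa0 <= kappa.
    rewrite -(leq_pmul2l (isT : 0 < 4)); apply: leq_trans le_n4k.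
    by near: n; exact: nbhs_infty_ge.
  apply: le_trans (lambda_le _ _ kappa0_le) _.
  by rewrite ler_wpM2l // ge0_ler_powR ?nnegrE // ler_nat.
have := coloring_space_quadratic t_gt0 le_tn (colA n) lambda_le_t.
rewrite -(ler_nat R) natrX natrM [(960 * _)%:R%R]natrM natrX; apply/negP.
rewrite -ltNge.
have : (960 * (C + 1) ^+ 2 * (n%:R `^ e) ^+ 2 * (s n)%:R < n%:R ^+ 2)%R.
  by near: n; exact: near_soft_linear_lt_sqr K_ge0 e_lt soft_s.
apply: le_lt_trans.
rewrite ler_wpM2r ?ler0n // -mulrA -exprMn ler_wpM2l ?ler0n //.
by rewrite lerXn2r ?nnegrE ?ler0n // (le_trans _ t_le) ?ler0n.
Unshelve. all: by end_near. Qed.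

Lemma no_semi_streaming_lt_half (R : realType) (lambda : nat -> nat -> nat)
    (C e : R) (kappa0 : nat) :
  (e < 2^-1)%R ->
  (forall n kappa, kappa0 <= kappa ->
     ((lambda n kappa)%:R <= C * kappa%:R `^ e)%R) ->
  ~ admits_semi_streaming R lambda.
Proof.
move=> e_lt lambda_le.
apply: (@no_semi_streaming_nneg_exponent _ _ `|C|%R (Num.max 0 e)%R
  (maxn 1 kappa0)) => [// | | n kappa].
  by rewrite le_max lexx gt_max e_lt invr_gt0 ltr0n.
rewrite geq_max => /andP[kappa_gt0 /lambda_le/le_trans]; apply.
apply: (@le_trans _ _ (`|C| * kappa%:R `^ e)%R).
  by rewrite ler_wpM2r ?powR_ge0 // ler_norm.
by rewrite ler_wpM2l // ler_powR ?ler1n // le_max lexx orbT.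
Qed.

Theorem theorem5p7 (R : realType) :
  (exists c : R, (0 < c)%R /\
     forall (lambda n s : nat) (A : rand_algorithm R n s),
       1 <= lambda -> lambda < n ->
       colors_with A (fun=> lambda) ->
       (c * (n%:R ^+ 2 / lambda%:R ^+ 2) <= s%:R)%R)
  /\
  (forall (gamma : R) (lambda : nat -> nat -> nat),
     (0 < gamma)%R ->
     (forall n kappa, 1 <= lambda n kappa) ->
     (exists (C : R) (kappa0 : nat), forall n kappa, kappa0 <= kappa ->
        ((lambda n kappa)%:R <= C * kappa%:R `^ (2^-1 - gamma))%R) ->
     ~ admits_semi_streaming R lambda).
Proof.
split.
  exists 960^-1%R; split=> [|lambda n s A]; first by rewrite invr_gt0 ltr0n.
  exact: coloring_space_lower_bound.
move=> gamma lambda gamma_gt0 _ [C [kappa0 lambda_le]].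
by apply: no_semi_streaming_lt_half lambda_le; lra.
Qed.
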